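(* Let $Q_i,Q_j$ be real positive semidefinite $n\times n$ matrices, $c_i\in\mathrm{Range}(Q_i)$, $c_j\in\mathrm{Range}(Q_j)$, $d_i,d_j\in\mathbb{R}$. For $t\in\{i,j\}$ put $\xi^t=\tfrac12Q_t^{\dagger}c_t$, suppose $\tfrac14c_t^TQ_t^{\dagger}c_t-d_t\ge0$ and put $l_t=\sqrt{\tfrac14c_t^TQ_t^{\dagger}c_t-d_t}$. Let $x\in\mathbb{R}^n$ and let $X$ be a symmetric $n\times n$ matrix with $\begin{pmatrix}1&x^T\\ x&X\end{pmatrix}\succeq0$. The SST constraint $$\left\|Q_i^{1/2}\left(X+x(\xi^j)^T+\xi^ix^T+\xi^i(\xi^j)^T\right)Q_j^{1/2}\right\|_F\le l_il_j,$$ generated by linearizing (replacing $xx^T$ by $X$) the product of $\|Q_i^{1/2}(x+\xi^i)\|\le l_i$ and $\|Q_j^{1/2}(x+\xi^j)\|\le l_j$, is dominated by the two constraints $$Q_i\cdot X+c_i^Tx+d_i\le0\quad\text{and}\quad Q_j\cdot X+c_j^Tx+d_j\le0,$$ i.e. it holds whenever these two constraints hold.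
   Context: $Q^{\dagger}$ is the Moore-Penrose pseudoinverse, $Q^{1/2}$ the positive semidefinite square root, $A\cdot B=\mathrm{tr}(A^TB)$, $\|\cdot\|$ the Euclidean norm, $\|\cdot\|_F$ the Frobenius norm. The two second order cone constraints are equivalent reformulations of the convex quadratic constraints $x^TQ_tx+c_t^Tx+d_t\le0$, $t=i,j$. *)

(* Defs.v *)
From HB Require Import structures.
From mathcomp Require Import all_boot all_order all_algebra.
From mathcomp Require Import boolp classical_sets reals.
From mathcomp Require Import spectral sesquilinear complex polyrcf.

Set Implicit Arguments.
Unset Strict Implicit.
Unset Printing Implicit Defensive.

Import Order.TTheory GRing.Theory Num.Theory.
Local Open Scope ring_scope.

Section Definitions.
Context {R : realType}.

Definition psdmx n (Q : 'M[R]_n) : Prop :=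
  Q^T = Q /\ forall v : 'cV[R]_n, 0 <= (v^T *m Q *m v) 0 0.

Definition mxdot m n (A B : 'M[R]_(m, n)) : R := \tr (A^T *m B).

Definition frobenius m n (A : 'M[R]_(m, n)) : R :=
  Num.sqrt (\sum_i \sum_j A i j ^+ 2).

Definition penrose m n (A : 'M[R]_(m, n)) (P : 'M[R]_(n, m)) : Prop :=
  [/\ A *m P *m A = A, P *m A *m P = P,
      (A *m P)^T = A *m P & (P *m A)^T = P *m A].

(* [pinvmx] of mxalgebra is only some partial inverse, in general not the
   Moore-Penrose one. The default value 0 is never used: see [mp_pinvP]. *)
Definition mp_pinv m n (A : 'M[R]_(m, n)) : 'M[R]_(n, m) :=
  xget 0 [set P | penrose A P]%classic.

(* The default value 0 is never used for a positive semidefinite [Q]: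
   see [psd_sqrtP]. *)
Definition psd_sqrt n (Q : 'M[R]_n) : 'M[R]_n :=
  xget 0 [set S | psdmx S /\ S *m S = Q]%classic.

Definition in_range m n (Q : 'M[R]_(m, n)) (c : 'cV[R]_m) : Prop :=
  exists y : 'cV[R]_n, c = Q *m y.

(* For psd [Q] with [c] in its range, completing the square turns
   x^T Q x + c^T x + d <= 0 into |Q^(1/2) (x + soc_center Q c)|^2
   <= soc_radius2 Q c d. *)
Definition soc_center n (Q : 'M[R]_n) (c : 'cV[R]_n) : 'cV[R]_n :=
  2^-1 *: (mp_pinv Q *m c).

Definition soc_radius2 n (Q : 'M[R]_n) (c : 'cV[R]_n) (d : R) : R :=
  4^-1 * (c^T *m mp_pinv Q *m c) 0 0 - d.

Definition soc_radius n (Q : 'M[R]_n) (c : 'cV[R]_n) (d : R) : R :=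
  Num.sqrt (soc_radius2 Q c d).

(* With [X] replaced by [x *m x^T] the middle factor is
   (x + xi_i) (x + xi_j)^T, and then [frobenius (sst_mx ...)] is the product
   |Qi^(1/2) (x + xi_i)| * |Qj^(1/2) (x + xi_j)| of Euclidean norms. *)
Definition sst_mx n (Qi Qj : 'M[R]_n) (xi_i xi_j x : 'cV[R]_n) (X : 'M[R]_n) :
    'M[R]_n :=
  psd_sqrt Qi *m (X + x *m xi_j^T + xi_i *m x^T + xi_i *m xi_j^T)
    *m psd_sqrt Qj.

End Definitions.

Section PseudoInverse.
Context {R : realType}.

Lemma mulmx_trmx_eq0 m n (A : 'M[R]_(m, n)) : A *m A^T = 0 -> A = 0.
Proof.
move=> /matrixP A0; apply/matrixP=> i j; rewrite mxE.
have := A0 i i; rewrite !mxE => /eqP.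
rewrite psumr_eq0; last by move=> k _; rewrite mxE -expr2 sqr_ge0.
move=> /allP/(_ j (mem_index_enum _)); rewrite /= mxE -expr2 sqrf_eq0.
by move/eqP.
Qed.

Lemma row_free_gram_unit m n (A : 'M[R]_(m, n)) :
  row_free A -> A *m A^T \in unitmx.
Proof.
move=> Afree; rewrite -row_free_unit -kermx_eq0; apply/eqP.
set K := kermx _.
have KAA : K *m (A *m A^T) = 0 by apply: mulmx_ker.
have /mulmx_trmx_eq0 KA0 : (K *m A) *m (K *m A)^T = 0.
  by rewrite trmx_mul !mulmxA -(mulmxA K) KAA mul0mx.
by apply/eqP; rewrite -(mulmx_free_eq0 _ Afree) KA0.
Qed.

Lemma penrose_mul m r n (C : 'M[R]_(m, r)) (B : 'M[R]_(r, n)) :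
  row_free C^T -> row_free B -> exists P, penrose (C *m B) P.
Proof.
move=> /row_free_gram_unit; rewrite trmxK => UC /row_free_gram_unit UB.
pose iB := invmx (B *m B^T); pose iC := invmx (C^T *m C).
have BV : B *m B^T *m iB = 1%:M by rewrite mulmxV.
have VB : iB *m (B *m B^T) = 1%:M by rewrite mulVmx.
have VC : iC *m (C^T *m C) = 1%:M by rewrite mulVmx.
have iBT : iB^T = iB by rewrite trmx_inv trmx_mul trmxK.
have iCT : iC^T = iC by rewrite trmx_inv trmx_mul trmxK.
pose P := B^T *m iB *m iC *m C^T.
have AP : C *m B *m P = C *m iC *m C^T.
  by rewrite /P !mulmxA -(mulmxA C B) -(mulmxA C _ iB) BV mulmx1.
have PA : P *m (C *m B) = B^T *m iB *m B.
  by rewrite /P !mulmxA -(mulmxA _ C^T C) -(mulmxA _ iC) VC mulmx1.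
exists P; split.
- by rewrite AP !mulmxA -(mulmxA _ C^T C) -(mulmxA C iC) VC mulmx1.
- by rewrite PA /P !mulmxA -(mulmxA _ B B^T) -(mulmxA B^T iB) VB mulmx1.
- by rewrite AP !trmx_mul trmxK iCT mulmxA.
- by rewrite PA !trmx_mul trmxK iBT mulmxA.
Qed.

Lemma penrose_exists m n (A : 'M[R]_(m, n)) : exists P, penrose A P.
Proof.
have := @penrose_mul _ _ _ (col_base A) (row_base A).
rewrite mulmx_base row_base_free; apply=> //.
by rewrite /row_free mxrank_tr; have := col_base_full A.
Qed.

Lemma penrose_unique m n (A : 'M[R]_(m, n)) P1 P2 :
  penrose A P1 -> penrose A P2 -> P1 = P2.
Proof.
move=> [a1 b1 c1 d1] [a2 b2 c2 d2].
have E1 : A *m P1 = A *m P2.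
  by rewrite -{1}a2 -mulmxA -c1 -c2 -trmx_mul mulmxA a1.
have E2 : P1 *m A = P2 *m A.
  by rewrite -{1}a2 -!mulmxA (mulmxA P1) -d1 -d2 -trmx_mul
             -mulmxA (mulmxA A P1) a1.
by rewrite -b1 E2 -mulmxA E1 mulmxA b2.
Qed.

Lemma mp_pinvP m n (A : 'M[R]_(m, n)) : penrose A (mp_pinv A).
Proof.
have [P AP] := penrose_exists A.
exact: (@xgetPex _ 0 [set P | penrose A P]%classic (ex_intro _ P AP)).
Qed.

End PseudoInverse.

Section SquareRoot.
Context {R : realType}.

Lemma interpolate (f : R -> R) (s : seq R) :
  exists p : {poly R}, {in s, forall a, p.[a] = f a}.
Proof.
elim: s => [|a s [p ps]]; first by exists 0.
have [as_|aNs] := boolP (a \in s).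
  by exists p => b; rewrite inE => /predU1P[->|]; apply: ps.
pose q := \prod_(b <- s) ('X - b%:P).
have qa : q.[a] != 0 by rewrite -/(root q a) root_prod_XsubC.
exists (p + ((f a - p.[a]) / q.[a]) *: q) => b.
rewrite inE hornerD hornerZ => /predU1P[->|bs].
  by rewrite mulfVK // addrC subrK.
have /eqP -> : root q b by rewrite root_prod_XsubC.
by rewrite mulr0 addr0 ps.
Qed.

Lemma psd_eigenvalue_ge0 n (Q : 'M[R]_n) a :
  psdmx Q -> eigenvalue Q a -> 0 <= a.
Proof.
move=> [_ Q0] /eigenvalueP[v vQ vN0].
have := Q0 v^T; rewrite trmxK vQ -scalemxAl mxE => h.
rewrite -(@pmulr_lge0 _ ((v *m v^T) 0 0)) //.
rewrite lt_neqAle eq_sym; apply/andP; split; last first.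
  by rewrite mxE sumr_ge0 // => i _; rewrite mxE -expr2 sqr_ge0.
apply: contra vN0 => /eqP vv0; apply/eqP/mulmx_trmx_eq0/matrixP => i j.
by rewrite !ord1 vv0 mxE.
Qed.

Lemma trmx_horner n (Q : 'M[R]_n.+1) p :
  Q^T = Q -> (horner_mx Q p)^T = horner_mx Q p.
Proof.
move=> QT; elim/poly_ind: p => [|p c IH]; first by rewrite raddf0 trmx0.
rewrite rmorphD rmorphM /= horner_mx_X horner_mx_C linearD /= tr_scalar_mx.
congr (_ + _); rewrite -[_ * Q]/(_ *m Q) trmx_mul QT IH.
exact: comm_mx_horner.
Qed.

Lemma psd_annihilated n (Q : 'M[R]_n.+1) (p : {poly R}) : psdmx Q ->
  (forall a, eigenvalue Q a -> p.[a] = 0) -> horner_mx Q p = 0.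
Proof.
move=> [QT _] p0; pose f := real_complex R.
apply: (@map_mx_inj _ _ f); rewrite raddf0 map_horner_mx.
set A := map_mx f Q.
have Areal : A \is a realmx.
  by apply/mxOverP => i j; rewrite mxE complex_real.
have Asym : A \is symmetricmx.
  by apply/is_hermitianmxP; rewrite scale1r map_mx_id // map_trmx QT.
have Aherm := realsym_hermsym Asym Areal.
have AE := orthomx_spectralP (hermitian_normalmx Aherm).
have dreal := hermitian_spectral_diag_real Aherm.
move: AE dreal (spectral_unit A).
move: (spectralmx A) (spectral_diag A) => U d AE dreal Uunit.
rewrite AE horner_mx_uconjC // horner_mx_diag.
suff -> : map_mx (horner (map_poly f p)) d = 0.
  by rewrite linear0 mulmx0 mul0mx.
apply/rowP => i; rewrite mxE [RHS]mxE.
have /complex_realP[a dE] : d 0 i \is Num.real by apply: (mxOverP dreal).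
rewrite dE -[(a%:C)%C]/(f a) horner_map p0 ?rmorph0 //.
rewrite eigenvalue_root_char -(fmorph_root f) map_char_poly -/A.
rewrite -eigenvalue_root_char; apply/eigenvalueP; exists (row i U).
  rewrite -row_mul {1}AE !mulmxA mulmxV // mul1mx row_mul row_diag_mx.
  by rewrite -scalemxAl -rowE dE.
apply/eqP => Ui0; have /rowP/(_ i) : delta_mx 0 i = 0 :> 'rV[R[i]]_n.+1.
  by rewrite -(mulmxK Uunit (delta_mx 0 i)) -rowE Ui0 mul0mx.
by rewrite !mxE !eqxx => /eqP; rewrite oner_eq0.
Qed.

Lemma psd_sqrt_exists n (Q : 'M[R]_n) :
  psdmx Q -> exists S, psdmx S /\ S *m S = Q.
Proof.
case: n Q => [|n] Q Qpsd.
  by exists Q; split=> //; apply/matrixP=> -[].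
have [s sP] : exists s : seq R, forall a, eigenvalue Q a -> a \in s.
  exists (rootsR (char_poly Q)) => a; rewrite eigenvalue_root_char.
  have := roots_on_rootsR (monic_neq0 (char_poly_monic Q)).
  by move=> /(_ a) <-; rewrite inE.
have [r rs] := interpolate (fun a => Num.sqrt (Num.sqrt a)) s.
have Q4 : horner_mx Q (r ^+ 4) = Q.
  apply/eqP; rewrite -subr_eq0 -{2}(horner_mx_X Q) -rmorphB /=.
  apply/eqP/psd_annihilated => // a Qa.
  rewrite hornerD hornerN hornerX horner_exp rs ?sP // (exprM _ 2 2).
  by rewrite !sqr_sqrtr ?sqrtr_ge0 ?subrr // (psd_eigenvalue_ge0 Qpsd).
pose T := horner_mx Q r.
have TT : T^T = T by apply: trmx_horner; case: Qpsd.
exists (T *m T); split; last first.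
  by rewrite -[RHS]Q4 rmorphXn /= (exprM _ 2 2).
split=> [|v]; first by rewrite trmx_mul TT.
rewrite mulmxA -{1}TT -trmx_mul -mulmxA mxE sumr_ge0 // => i _.
by rewrite mxE -expr2 sqr_ge0.
Qed.

Lemma psd_sqrtP n (Q : 'M[R]_n) :
  psdmx Q -> psdmx (psd_sqrt Q) /\ psd_sqrt Q *m psd_sqrt Q = Q.
Proof.
move=> /psd_sqrt_exists[S QS].
exact: (@xgetPex _ 0 [set S | psdmx S /\ S *m S = Q]%classic
          (ex_intro _ S QS)).
Qed.

End SquareRoot.

(* Main.v *)
Require Import Defs.
From mathcomp Require Import all_boot all_order all_algebra.
From mathcomp Require Import reals.
From mathcomp Require Import ring lra.
Import Order.TTheory GRing.Theory Num.Theory.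
Local Open Scope ring_scope.

(** Let [M] be the positive semidefinite block matrix [1, x^T; x, X] and write
    [M = W W^T] with [W] its square root. For a vector [xi] put
    [B = (xi | I)]. Then [B_i M B_j^T] is the linearization of
    [(x + xi_i) (x + xi_j)^T], so the matrix of the SST constraint factors as
    [(Qi^(1/2) B_i W) (Qj^(1/2) B_j W)^T]. The Frobenius norm is
    submultiplicative ([frobenius_mulmx_tr]), so it remains to bound the norm
    of each factor [Q^(1/2) B W]. Its square is the trace of
    [Q (X + x xi^T + xi x^T + xi xi^T)], and since [Q xi = c / 2]
    ([mulmx_soc_center]) this equals
    [Q . X + c^T x + (c^T Q^+ c) / 4] ([mxtrace_lifted_square]), which is at
    most [l^2] exactly when the linearized quadratic constraint holds. *)

(** The defect of the inequality is half the sum of the squares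
    [(a i * b j - a j * b i) ^+ 2] (Lagrange's identity). *)
Lemma sum_cauchy_schwarz (R : realFieldType) (I : finType) (a b : I -> R) :
  (\sum_i a i * b i) ^+ 2 <= (\sum_i a i ^+ 2) * (\sum_i b i ^+ 2).
Proof.
have : 0 <= \sum_i \sum_j (a i * b j - a j * b i) ^+ 2.
  by do 2![apply: sumr_ge0 => ? _]; apply: sqr_ge0.
have -> : \sum_i \sum_j (a i * b j - a j * b i) ^+ 2 =
    \sum_i \sum_j a i ^+ 2 * b j ^+ 2 + \sum_i \sum_j b i ^+ 2 * a j ^+ 2
    - 2 * \sum_i \sum_j (a i * b i) * (a j * b j).
  rewrite mulr_sumr -big_split -sumrB /=; apply: eq_bigr => i _.
  rewrite mulr_sumr -big_split -sumrB /=; apply: eq_bigr => j _.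
  by ring.
rewrite -!big_distrlr /=; lra.
Qed.

Section Frobenius.
Context {R : realType}.

Lemma frobenius_ge0 {m n} (A : 'M[R]_(m, n)) : 0 <= frobenius A.
Proof. exact: sqrtr_ge0. Qed.

Lemma frobenius_trace m n (A : 'M[R]_(m, n)) :
  frobenius A = Num.sqrt (\tr (A *m A^T)).
Proof.
congr (Num.sqrt _); apply: eq_bigr => i _; rewrite mxE.
by apply: eq_bigr => j _; rewrite mxE expr2.
Qed.

(** Each entry of [A *m B^T] is a scalar product of a row of [A] and a row of
    [B], to which the Cauchy-Schwarz inequality applies. *)
Lemma frobenius_mulmx_tr m n p (A : 'M[R]_(m, p)) (B : 'M[R]_(n, p)) :
  frobenius (A *m B^T) <= frobenius A * frobenius B.
Proof.
rewrite -sqrtrM; last by do 2![apply: sumr_ge0 => ? _]; apply: sqr_ge0.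
apply: ler_wsqrtr; rewrite big_distrlr /=.
apply: ler_sum => i _; apply: ler_sum => j _; rewrite mxE.
have -> : \sum_k A i k * B^T k j = \sum_k A i k * B j k.
  by apply: eq_bigr => k _; rewrite mxE.
exact: sum_cauchy_schwarz.
Qed.

End Frobenius.

(** For [X = x x^T] the block matrix is the square of the column [(1; x)], which
    [(xi | I)] maps to [x + xi]; hence the product linearizes
    [(x + xi1) (x + xi2)^T]. *)
Lemma lifted_product (R : comNzRingType) n (xi1 xi2 x : 'cV[R]_n) (X : 'M[R]_n) :
  row_mx xi1 1%:M *m block_mx (1%:M : 'M[R]_1) x^T x X *m (row_mx xi2 1%:M)^T
  = X + x *m xi2^T + xi1 *m x^T + xi1 *m xi2^T.
Proof.
rewrite tr_row_mx trmx1 mul_row_block mul_row_col !mul1mx !mulmx1 mulmxDl.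
by rewrite [LHS](AC (2 * 2) (4 * 2 * 3 * 1)).
Qed.

Section SecondOrderCone.
Context {R : realType}.

(** As [c] lies in the range of [Q], the projection [Q Q^+] fixes it. *)
Lemma mulmx_soc_center n (Q : 'M[R]_n) (c : 'cV[R]_n) :
  in_range Q c -> Q *m soc_center Q c = 2^-1 *: c.
Proof.
move=> [y ->]; have [QPQ _ _ _] := mp_pinvP Q.
by rewrite /soc_center -scalemxAr !mulmxA QPQ.
Qed.

(** Completing the square: for [X = x x^T] the left side is
    [(x + xi)^T Q (x + xi)]. *)
Lemma mxtrace_lifted_square n (Q X : 'M[R]_n) (c x : 'cV[R]_n)
    (xi := soc_center Q c) : Q^T = Q -> in_range Q c ->
  \tr (Q *m (X + x *m xi^T + xi *m x^T + xi *m xi^T)) =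
  mxdot Q X + mxdot c x + 4^-1 * (c^T *m mp_pinv Q *m c) 0 0.
Proof.
move=> QT Qc; have Qxi : Q *m xi = 2^-1 *: c by apply: mulmx_soc_center.
have xiQ : xi^T *m Q = 2^-1 *: c^T by rewrite -{1}QT -trmx_mul Qxi linearZ.
rewrite !mulmxDr !linearD /=.
have -> : \tr (Q *m (x *m xi^T)) = 2^-1 * mxdot c x.
  by rewrite mulmxA mxtrace_mulC mulmxA xiQ -scalemxAl linearZ.
have -> : \tr (Q *m (xi *m x^T)) = 2^-1 * mxdot c x.
  by rewrite mulmxA Qxi -scalemxAl linearZ /= -mxtrace_tr trmx_mul trmxK
             mxtrace_mulC.
have -> : \tr (Q *m (xi *m xi^T)) =
    4^-1 * (c^T *m mp_pinv Q *m c) 0 0.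
  rewrite mulmxA mxtrace_mulC mulmxA xiQ /xi /soc_center -scalemxAl.
  rewrite -scalemxAr scalerA linearZ /= mulmxA trace_mx11; congr (_ * _).
  by field.
by rewrite /mxdot QT; field.
Qed.

(** The square of the left side is the trace computed in
    [mxtrace_lifted_square], whatever factor [W] of the block matrix is chosen;
    the same [W] can thus serve two different [Q]. *)
Lemma frobenius_lifted_le n m (Q X : 'M[R]_n) (c x : 'cV[R]_n) (d : R)
    (W : 'M[R]_(1 + n, m)) :
  psdmx Q -> in_range Q c ->
  W *m W^T = block_mx (1%:M : 'M[R]_1) x^T x X ->
  mxdot Q X + mxdot c x + d <= 0 ->
  frobenius (psd_sqrt Q *m row_mx (soc_center Q c) 1%:M *m W)
    <= soc_radius Q c d.
Proof.
move=> Qpsd Qc WW Qle0; have [[ST _] SS] := psd_sqrtP Qpsd.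
rewrite frobenius_trace; apply: ler_wsqrtr.
set S := psd_sqrt Q in ST SS *; set B := row_mx _ _.
have -> : \tr (S *m B *m W *m (S *m B *m W)^T) =
    \tr (Q *m (B *m (W *m W^T) *m B^T)).
  by rewrite !trmx_mul ST !mulmxA mxtrace_mulC !mulmxA SS.
rewrite WW lifted_product mxtrace_lifted_square //; last by case: Qpsd.
by rewrite /soc_radius2; lra.
Qed.

End SecondOrderCone.

Theorem theorem4p3 (R : realType) (n : nat) (Qi Qj : 'M[R]_n)
    (ci cj : 'cV[R]_n) (di dj : R) (x : 'cV[R]_n) (X : 'M[R]_n)
    (Qi_psd : psdmx Qi) (Qj_psd : psdmx Qj)
    (ci_range : in_range Qi ci) (cj_range : in_range Qj cj)
    (li_ge0 : 0 <= soc_radius2 Qi ci di)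
    (lj_ge0 : 0 <= soc_radius2 Qj cj dj)
    (X_sym : X^T = X)
    (xX_psd : psdmx (block_mx (1%:M : 'M[R]_1) x^T x X)) :
  mxdot Qi X + mxdot ci x + di <= 0 ->
  mxdot Qj X + mxdot cj x + dj <= 0 ->
  frobenius (sst_mx Qi Qj (soc_center Qi ci) (soc_center Qj cj) x X)
    <= soc_radius Qi ci di * soc_radius Qj cj dj.
Proof.
move=> Qi_le0 Qj_le0.
have [[WT _]] := psd_sqrtP xX_psd; rewrite -{2}WT.
move: (psd_sqrt _) => W WW.
have [[SjT _] _] := psd_sqrtP Qj_psd.
pose F Q c := psd_sqrt Q *m row_mx (soc_center Q c) 1%:M *m W.
have -> : sst_mx Qi Qj (soc_center Qi ci) (soc_center Qj cj) x X =
    F Qi ci *m (F Qj cj)^T.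
  rewrite /sst_mx -lifted_product -WW /F !trmx_mul SjT.
  by rewrite !mulmxA.
apply: le_trans (frobenius_mulmx_tr _ _ _ _ _) _.
by apply: ler_pM (frobenius_ge0 _) (frobenius_ge0 _) _ _;
  apply: frobenius_lifted_le WW _.
Qed.
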